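(* Let $(N_0,N_1,N_2,\ldots)$ be an infinite sequence of positive integers of at most polynomial growth (i.e., there are constants $a,p\ge0$ with $N_i\le a(i+1)^p$ for all $i$). For each $n$ let $\bm{N}^{(n)}=(N_0,\ldots,N_{n-1},-\sum_{i=0}^{n-1}N_i)\in\mathbb{Z}^{n+1}$. Then \[ \lim_{n\to\infty}\frac{\log K_n(\bm{N}^{(n)})}{\sup_{\bm{f}\in\mathcal{F}_n(\bm{N}^{(n)})}\mathcal{H}(\bm{f})}=1. \]
   Context: $\mathcal{F}_n(\bm{N})$ is the set of $\bm{f}=(f_{ij})_{0\le i<j\le n}\in\mathbb{R}_{\ge0}^{\binom{n+1}{2}}$ with $\sum_{j>i} f_{ij}-\sum_{k<i} f_{ki}=N_i$ for every $i\in\{0,\ldots,n\}$, and $K_n(\bm{N})$ is its number of integer points. Let $h(t):=(t+1)\log(t+1)-t\log t$ ($0\log0=0$), and for $\bm{f}\in\mathcal{F}_n(\bm{N})$ define the flow entropy $\mathcal{H}(\bm{f}):=\sum_{0\le i<j\le n} h(f_{ij})+\sum_{0<j<n} h\big(\sum_{0\le i<j}(N_i-f_{ij})\big)$. *)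

(* Defs.v *)
From HB Require Import structures.
From mathcomp Require Import all_boot all_order all_algebra.
From mathcomp Require Import all_classical all_reals all_analysis.
From mathcomp Require Import finmap.
Set Implicit Arguments. Unset Strict Implicit. Unset Printing Implicit Defensive.
Import Order.TTheory GRing.Theory Num.Theory.
Import numFieldNormedType.Exports.
Local Open Scope classical_set_scope.
Local Open Scope ring_scope.

Definition edge (n : nat) : finType :=
  {p : 'I_n.+1 * 'I_n.+1 | (p.1 < p.2)%N}.

Definition is_flow {R : realType} (n : nat) (N : 'I_n.+1 -> int)
    (f : edge n -> R) : Prop :=
  (forall e, 0 <= f e) /\
  forall i : 'I_n.+1,
    \sum_(e : edge n | (val e).1 == i) f e
      - \sum_(e : edge n | (val e).2 == i) f e = (N i)%:~R.

Definition flow_polytope (R : realType) (n : nat) (N : 'I_n.+1 -> int)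
  : set (edge n -> R) := [set f | is_flow N f].

Definition int_flows (n : nat) (N : 'I_n.+1 -> int) : set {ffun edge n -> nat} :=
  [set g | forall i : 'I_n.+1,
     ((\sum_(e : edge n | (val e).1 == i) g e)%:Z
      - (\sum_(e : edge n | (val e).2 == i) g e)%:Z = N i)%R].

(* K_n(N): number of integer points (the set is finite). *)
Definition Kn (n : nat) (N : 'I_n.+1 -> int) : nat := (#|` fset_set (int_flows N)|)%fset.

Definition h {R : realType} (t : R) : R :=
  (t + 1) * ln (t + 1) - (if t == 0 then 0 else t * ln t).

Definition flow_entropy {R : realType} (n : nat) (N : 'I_n.+1 -> int)
    (f : edge n -> R) : R :=
  \sum_(e : edge n) h (f e)
  + \sum_(j : 'I_n.+1 | (0 < j < n)%N)
      h (\sum_(e : edge n | (val e).2 == j) ((N (val e).1)%:~R - f e)).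

Definition Nvec (N : nat -> nat) (n : nat) : 'I_n.+1 -> int :=
  fun i => if (i < n)%N then (N i)%:Z else - (\sum_(k < n) N k)%:Z.
Arguments Nvec N n i : clear implicits.

(* Main.v *)
(** An edge (i, j) is viewed as the interval of points k with i < k <= j.  A flow
is then a nonnegative weighting of intervals that covers each point k <= n with
total weight S_k = N_0 + ... + N_(k-1), and since the unit interval (k-1, k) covers
only k, the integer flows correspond to the integer packings (cover at most S_k) by
intervals of length at least 2.

Upper bound: Gibbs' inequality, comparing the uniform distribution on integer flows
with the product of geometric distributions of the same means, gives
log K <= sup H.

Lower bound: cut the intervals, up to O(n) short ones, into O(n) blocks of intervals
with close endpoints, and replace each block by an inner block, of almost the same
size, of intervals contained in all intervals of the block; inner blocks of distinct
blocks are disjoint.  If a flow f puts mass F on a block, then any choice of at most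
F intervals with repetition in every inner block is a packing.  By concavity of h,
the number of choices is exp(entropy of f on the block), up to a factor polynomial
in n and an exponent 1 + o(1).  Hence sup H <= (1 + eps) log K + O(n log n).

Finally sup H >= c n log^2 n, by weighting the intervals of length d by 1/d, so the
error O(n log n) is negligible. *)

Require Import Defs.
From HB Require Import structures.
From mathcomp Require Import all_boot all_order all_algebra.
From mathcomp Require Import all_classical all_reals all_analysis.
From mathcomp Require Import finmap zify ring lra.
Set Implicit Arguments.
Unset Strict Implicit.
Unset Printing Implicit Defensive.
Import Order.TTheory GRing.Theory Num.Theory.
Import numFieldNormedType.Exports.
Local Open Scope classical_set_scope.
Local Open Scope ring_scope.

(** * The function h *)


Lemma ln_le_subr1 (R : realType) (x : R) : 0 < x -> ln x <= x - 1.
Proof.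
move=> x0; have := @le_ln1Dx R (x - 1).
rewrite (_ : 1 + (x - 1) = x); last by ring.
by apply; lra.
Qed.

Lemma hE (R : realType) (t : R) : h t = (1 + t) * ln (1 + t) - t * ln t.
Proof. by rewrite /h (addrC t); case: eqP => [->|//]; rewrite mul0r. Qed.

Lemma h0 (R : realType) : h (0 : R) = 0.
Proof. by rewrite hE addr0 ln1 mulr0 mul0r subrr. Qed.

(** Here [h y] is the entropy of the geometric law of mean [y], and the right side its cross entropy
    with the law of mean [x]. Gibbs' inequality follows from [ln z <= z - 1] at [r] and at
    [r * x / y]; the two right sides, weighted by [1] and [y], cancel because
    [r + r * x = 1 + y]. *)
Lemma h_tangent (R : realType) (x y : R) : 0 < x -> 0 <= y ->
  h y <= (1 + y) * ln (1 + x) - y * ln x.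
Proof.
move=> x0; rewrite le_eqVlt => /predU1P[<-|y0].
  by rewrite h0 addr0 mul1r mul0r subr0 ln_ge0 // lerDl ltW.
have x1 : 0 < 1 + x by lra.
have y1 : 0 < 1 + y by lra.
have [r [r0 lnr rx]] : exists r : R,
    [/\ 0 < r, ln r = ln (1 + y) - ln (1 + x) & r + r * x = 1 + y].
  exists ((1 + y) / (1 + x)); split; rewrite ?divr_gt0 ?ln_div ?posrE //.
  by field; rewrite gt_eqF.
have e1 := ln_le_subr1 r0.
have e2 : ln (r * x / y) <= r * x / y - 1.
  by apply: ln_le_subr1; rewrite divr_gt0 // mulr_gt0.
have e3 : y * ln (r * x / y) <= r * x - y.
  rewrite (le_trans (ler_wpM2l (ltW y0) e2)) // le_eqVlt; apply/orP; left.
  by apply/eqP; field; rewrite gt_eqF.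
move: e3; rewrite ln_div ?posrE ?mulr_gt0 // lnM ?posrE //.
rewrite hE; nra.
Qed.

Lemma h_at (R : realType) (x : R) : h x = ln (1 + x) + x * (ln (1 + x) - ln x).
Proof. by rewrite hE; ring. Qed.

(** Concavity: [ln (1 + x) - ln x] is the derivative of [h] at [x]. *)
Lemma h_le_tangent (R : realType) (x y : R) : 0 < x -> 0 <= y ->
  h y <= h x + (y - x) * (ln (1 + x) - ln x).
Proof.
move=> x0 y0; apply: le_trans (h_tangent x0 y0) _.
by rewrite h_at le_eqVlt; apply/orP; left; apply/eqP; ring.
Qed.

Lemma h_homo (R : realType) (x y : R) : 0 <= x -> x <= y -> h x <= h y.
Proof.
move=> x0 xy; have [y0|y0] := ltP 0 y; last by have -> : x = y by lra.
apply: le_trans (h_le_tangent y0 x0) _.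
have : ln y <= ln (1 + y) by rewrite ler_ln ?posrE; lra.
nra.
Qed.

Lemma h_ge0 (R : realType) (x : R) : 0 <= x -> 0 <= h x.
Proof. by move=> x0; rewrite -(h0 R) h_homo. Qed.

Lemma h_le_ln (R : realType) (x : R) : 0 <= x -> h x <= ln (1 + x) + 1.
Proof.
move=> x0; rewrite h_at lerD2l.
move: x0; rewrite le_eqVlt => /predU1P[<-|x0]; first by rewrite mul0r.
rewrite -ln_div ?posrE //; last by lra.
apply: (@le_trans _ _ (x * ((1 + x) / x - 1))).
  by apply: ler_wpM2l; rewrite ?(ltW x0) // ln_le_subr1 // divr_gt0 //; lra.
by rewrite le_eqVlt; apply/orP; left; apply/eqP; field; rewrite gt_eqF.
Qed.

(* Jensen's inequality: since [h 0 = 0], the number of terms may be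
   smaller than the weight [M]. *)
Lemma sum_h_le (R : realType) (I : finType) (P : pred I) (f : I -> R) (M : R) :
  0 < M -> (forall i, P i -> 0 <= f i) -> #|P|%:R <= M ->
  \sum_(i | P i) h (f i) <= M * h ((\sum_(i | P i) f i) / M).
Proof.
move=> M0 f0 PM; set F := \sum_(i | P i) f i.
have F0 : 0 <= F by exact: sumr_ge0.
move: (F0); rewrite le_eqVlt => /predU1P[FE|Fgt0].
  rewrite -FE mul0r h0 mulr0 big1 // => i Pi.
  by have /psumr_eq0P -> // : F = 0; rewrite ?h0.
set x := F / M; have x0 : 0 < x by rewrite divr_gt0.
apply: (@le_trans _ _ (\sum_(i | P i) (ln (1 + x) + f i * (ln (1 + x) - ln x)))).
  apply: ler_sum => i Pi; have := h_tangent x0 (f0 _ Pi); lra.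
rewrite big_split /= sumr_const -mulr_suml -/F h_at (mulrDr M).
have -> : M * (x * (ln (1 + x) - ln x)) = F * (ln (1 + x) - ln x).
  by rewrite mulrA /x; congr (_ * _); field; rewrite gt_eqF.
rewrite lerD2r -mulr_natl ler_wpM2r // ln_ge0 //; lra.
Qed.

(** Replaces the size of a block by that of its inner block, at the price of their ratio. *)
Lemma scaled_h_le (R : realType) (F M M' : R) : 0 < M' -> M' <= M -> 0 <= F ->
  M * h (F / M) <= M / M' * (M' * h (F / M')).
Proof.
move=> M'0 M'M F0.
have M0 : 0 < M by lra.
rewrite mulrA divfK ?gt_eqF //; apply: ler_wpM2l; rewrite ?(ltW M0) //.
apply: h_homo; first by rewrite divr_ge0 // ltW.
by rewrite ler_wpM2l // lef_pV2 ?posrE.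
Qed.

(** Raising [m] by one multiplies the binomial coefficient by [(1 + y) / y], where
    [y = (m + 1) / M]. The logarithm of this factor is the slope of [h] at [y], so by concavity the
    left side grows no faster. The base case is the symmetry [x * h (1 / x) = h x]. *)
Lemma h_le_ln_bin (R : realType) (M m : nat) : (0 < M)%N ->
  M%:R * h (m.+1%:R / M%:R : R) <= ln ('C(M + m, m)%:R) + (ln (1 + M%:R) + 1).
Proof.
move=> M0; have M0' : 0 < M%:R :> R by rewrite ltr0n.
elim: m => [|m IH].
  rewrite bin0 ln1 add0r; set x : R := M%:R in M0' *.
  have -> : x * h (1 / x) = h x.
    rewrite !hE -[ln (1 + 1 / x)](_ : ln ((1 + x) / x) = _); last first.
      by congr ln; field; rewrite gt_eqF.
    rewrite ln_div ?posrE //; last by lra.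
    rewrite ln_div ?posrE // ln1; field; by rewrite gt_eqF.
  by apply: h_le_ln; lra.
set y : R := m.+1%:R / M%:R.
have y0 : 0 < y by rewrite divr_gt0 // ltr0n.
have -> : m.+2%:R / M%:R = y + M%:R^-1 :> R.
  by rewrite /y -[m.+2]addn1 natrD mulrDl mul1r.
have step := @h_le_tangent R y (y + M%:R^-1) y0.
have {}step : M%:R * h (y + M%:R^-1) <= M%:R * h y + (ln (1 + y) - ln y).
  have := step _; rewrite (addrAC y) subrr add0r => step'.
  have {}step' : h (y + M%:R^-1) <= h y + M%:R^-1 * (ln (1 + y) - ln y).
    by apply: step'; rewrite addr_ge0 // ?invr_ge0 ltW.
  apply: le_trans (ler_wpM2l (ltW M0') step') _.
  by rewrite mulrDr mulrA divff ?gt_eqF // mul1r.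
apply: le_trans step _.
have -> : ln ('C(M + m.+1, m.+1)%:R) = ln ('C(M + m, m)%:R) + (ln (1 + y) - ln y) :> R.
  have b0 : 0 < 'C(M + m, m)%:R :> R by rewrite ltr0n bin_gt0 leq_addl.
  have y1 : 0 < 1 + y by lra.
  rewrite -ln_div ?posrE // -lnM ?posrE ?divr_gt0 //; congr ln.
  have E : m.+1%:R * 'C(M + m.+1, m.+1)%:R = (M + m.+1)%:R * 'C(M + m, m)%:R :> R.
    by rewrite -!natrM addnS mul_bin_diag.
  have m0 : m.+1%:R != 0 :> R by rewrite pnatr_eq0.
  apply: (mulfI m0); rewrite E natrD /y.
  field; rewrite -?natr1; apply/andP; split; rewrite ?gt_eqF // natr1 ?ltr0n //.
lra.
Qed.

(** * Counting bounds *)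


Lemma ln_prod (R : realType) (I : finType) (F : I -> R) :
  (forall i, 0 < F i) -> ln (\prod_i F i) = \sum_i ln (F i).
Proof.
move=> F0; suff [] : 0 < \prod_i F i /\ ln (\prod_i F i) = \sum_i ln (F i) by [].
elim/big_rec2: _ => [|i x y _ [y0 <-]]; first by rewrite ln1.
by rewrite mulr_gt0 // lnM ?posrE.
Qed.

Lemma geometric_partial_sum_le1 (R : realType) (m : R) (n : nat) : 0 <= m ->
  \sum_(k < n) m ^+ k / (1 + m) ^+ k.+1 <= 1.
Proof.
move=> m0; have m1 : 1 + m != 0 by rewrite gt_eqF //; lra.
suff -> : \sum_(k < n) m ^+ k / (1 + m) ^+ k.+1 = 1 - (m / (1 + m)) ^+ n.
  by rewrite gerBl exprn_ge0 // divr_ge0 // addr_ge0.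
elim: n => [|n IH]; first by rewrite big_ord0 expr0 subrr.
rewrite big_ord_recr /= IH !expr_div_n !exprS; field.
by rewrite m1 expf_neq0.
Qed.

(* Gibbs' inequality against the product of geometric distributions whose means
   are the coordinate averages over [A]. *)
Lemma ln_card_le_sum_h (R : realType) (I : finType) (B : nat)
    (A : {set {ffun I -> 'I_B.+1}}) : (0 < #|A|)%N ->
  ln (#|A|%:R : R) <= \sum_i h ((\sum_(x in A) (x i)%:R) / #|A|%:R).
Proof.
move=> A0; set K : R := #|A|%:R; have K0 : 0 < K by rewrite ltr0n.
pose s i : R := \sum_(x in A) (x i)%:R.
have s0 i : 0 <= s i by exact: sumr_ge0.
pose m i : R := s i / K.
have m0 i : 0 <= m i by rewrite divr_ge0 // ltW.
have m1 i : 0 < 1 + m i by rewrite ltr_pwDl.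
have mK i : K * m i = s i by rewrite /m; field; rewrite gt_eqF.
(* A coordinate of mean 0 vanishes on all of [A]; there [0 ^+ 0 = 1] keeps [p i (x i)] positive. *)
have mx x i : x \in A -> m i = 0 -> x i = 0%N :> nat.
  move=> xA mi; have /psumr_eq0P H : s i = 0 by rewrite -mK mi mulr0.
  by apply/eqP; rewrite -(pnatr_eq0 R) H.
pose p i (k : nat) : R := m i ^+ k / (1 + m i) ^+ k.+1.
have p0 i k : 0 <= p i k by rewrite divr_ge0 // exprn_ge0 // ltW.
pose P (x : {ffun I -> 'I_B.+1}) := \prod_i p i (x i).
have P0 x : 0 <= P x by exact: prodr_ge0.
have px x i : x \in A -> 0 < p i (x i).
  move=> xA; rewrite /p; have [mi|mi] := eqVneq (m i) 0.
    by rewrite (mx _ _ xA mi) expr0 divr_gt0 // exprn_gt0.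
  by rewrite divr_gt0 // exprn_gt0 // lt_neqAle eq_sym mi m0.
have lnp x i : x \in A ->
    ln (p i (x i)) = (x i)%:R * ln (m i) - ((x i)%:R + 1) * ln (1 + m i).
  move=> xA; rewrite /p; have [mi|mi] := eqVneq (m i) 0.
    by rewrite (mx _ _ xA mi) mi expr0 addr0 expr1n divr1 ln1; ring.
  have mi0 : 0 < m i by rewrite lt_neqAle eq_sym mi m0.
  rewrite ln_div ?posrE ?exprn_gt0 // !lnXn // -[(x i).+1]addn1.
  by rewrite -[in LHS]mulr_natl -[ln (1 + m i) *+ _]mulr_natl natrD.
have sumP : \sum_(x in A) P x <= 1.
  apply: (@le_trans _ _ (\sum_x P x)).
    by rewrite [leRHS](bigID (mem A)) /= lerDl sumr_ge0.
  rewrite /P -(bigA_distr_bigA (fun i (k : 'I_B.+1) => p i k)) /=.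
  rewrite prodr_ile1 // => i _; rewrite sumr_ge0 //=.
  exact: geometric_partial_sum_le1.
have gibbs : \sum_(x in A) ln (K * P x) <= 0.
  apply: (@le_trans _ _ (\sum_(x in A) (K * P x - 1))).
    apply: ler_sum => x xA; apply: ln_le_subr1.
    by rewrite mulr_gt0 // prodr_gt0 // => i _; exact: px.
  rewrite sumrB -mulr_sumr sumr_const -/K subr_le0 -[leRHS]mulr1.
  by rewrite ler_wpM2l // ltW.
rewrite -(ler_pM2l K0) mulr_sumr.
have {gibbs}: K * ln K + \sum_(x in A) \sum_i ln (p i (x i)) <= 0.
  apply: le_trans gibbs; rewrite -[K * _](_ : \sum_(x in A) ln K = _); last first.
    by rewrite sumr_const -mulr_natl.
  rewrite -big_split /=; apply: ler_sum => x xA.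
  have Px : 0 < P x by rewrite prodr_gt0 // => i _; exact: px.
  rewrite lnM ?posrE // lerD2l /P le_eqVlt; apply/orP; left; apply/eqP.
  by rewrite ln_prod // => i; exact: px.
suff -> : \sum_(x in A) \sum_i ln (p i (x i)) = - \sum_i K * h (s i / K) by rewrite subr_le0.
rewrite exchange_big /= -sumrN; apply: eq_bigr => i _.
rewrite (eq_bigr (fun x : {ffun I -> 'I_B.+1} =>
  (x i)%:R * ln (m i) - ((x i)%:R + 1) * ln (1 + m i))); last first.
  by move=> x; exact: lnp.
rewrite sumrB -!mulr_suml big_split /= sumr_const -/(s i) -/K -/(m i) hE -mK.
ring.
Qed.

(** Stars and bars: multisets of at most [m] elements of [J]. The codomain excludes none of them,
    since the sum bounds every value. *)
Lemma card_ffun_sum_le (J : finType) (m : nat) :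
  #|[set y : {ffun J -> 'I_m.+1} | (\sum_j y j <= m)%N]%SET| = 'C(#|J| + m, m).
Proof.
rewrite -(card_imset _ (can_inj (@fgraphK J 'I_m.+1))).
rewrite -[RHS]bin_sub ?leq_addl // addnK -card_partial_ord_partitions.
apply: eq_card => t; rewrite !inE; apply/imsetP/idP => [[y + ->]|tm].
  by rewrite inE -codom_ffun big_image.
exists (Finfun t); rewrite ?FinfunK // inE.
rewrite -[t]FinfunK -codom_ffun big_image /= in tm.
by [].
Qed.

Lemma card_dffun_sum_le (L : finType) (J : L -> finType) (m : L -> nat) :
  #|[set y : {dffun forall l, {ffun J l -> 'I_(m l).+1}} |
      [forall l, (\sum_j y l j <= m l)%N]]%SET|
  = (\prod_l 'C(#|J l| + m l, m l))%N.
Proof.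
pose F l := [pred y : {ffun J l -> 'I_(m l).+1} | (\sum_j y j <= m l)%N].
rewrite cardsE.
rewrite -[LHS](_ : #|(family F :
    simpl_pred {dffun forall l, {ffun J l -> 'I_(m l).+1}})| = _); last first.
  by apply: eq_card => y; apply/familyP/forallP.
rewrite card_family foldrE big_map big_enum /=.
by apply: eq_bigr => l _; rewrite -card_ffun_sum_le cardsE.
Qed.

(** * Cuts of flows *)


Definition src n (e : edge n) : nat := (val e).1.
Definition dst n (e : edge n) : nat := (val e).2.

(** The flow from the vertices below [k] to the others. An arbitrary [nmodType] lets natural and
    real weights share the lemmas. *)
Definition cut n (V : nmodType) (f : edge n -> V) (k : nat) : V :=
  \sum_(e : edge n | (src e < k <= dst e)%N) f e.

Definition psum (N : nat -> nat) (k : nat) : nat := (\sum_(i < k) N i)%N.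

Lemma src_lt_dst n (e : edge n) : (src e < dst e)%N.
Proof. exact: (valP e). Qed.

Lemma dst_le n (e : edge n) : (dst e <= n)%N.
Proof. by rewrite -ltnS ltn_ord. Qed.

Lemma edge_eq n (e e' : edge n) : src e = src e' -> dst e = dst e' -> e = e'.
Proof.
move=> es ed; apply: val_inj; move: es ed; rewrite /src /dst.
by case: (val e) (val e') => [a b] [c d] /= /val_inj -> /val_inj ->.
Qed.

Lemma edge_exists n (i j : nat) : (i < j)%N -> (j <= n)%N ->
  exists e : edge n, src e = i /\ dst e = j.
Proof.
move=> ij jn; have i_n : (i < n.+1)%N by lia.
by exists (exist _ (Ordinal i_n, Ordinal (jn : (j < n.+1)%N)) ij).
Qed.

Lemma cut0 n (V : nmodType) (f : edge n -> V) : cut f 0 = 0.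
Proof. by rewrite /cut big_pred0 // => e; rewrite ltn0. Qed.

Lemma cutS n (V : nmodType) (f : edge n -> V) : cut f n.+1 = 0.
Proof. by rewrite /cut big_pred0 // => e; have := dst_le e; lia. Qed.

Lemma psumS (N : nat -> nat) (k : nat) : psum N k.+1 = (psum N k + N k)%N.
Proof. by rewrite /psum big_ord_recr. Qed.

Lemma psum_ge (N : nat -> nat) (k : nat) :
  (forall i, (0 < N i)%N) -> (k <= psum N k)%N.
Proof. by move=> N0; elim: k => // k IH; rewrite psumS; have := N0 k; lia. Qed.

Lemma psum_homo (N : nat -> nat) (k l : nat) :
  (k <= l)%N -> (psum N k <= psum N l)%N.
Proof.
elim: l => [|l IH]; first by rewrite leqn0 => /eqP ->.
by rewrite leq_eqVlt => /predU1P[-> //|/IH]; rewrite psumS; lia.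
Qed.

(** An edge that covers [i + 1] but not [i] starts at [i]; one that covers [i] but not [i + 1] ends
    at [i]. *)
Lemma cut_diff n (V : zmodType) (f : edge n -> V) (i : 'I_n.+1) :
  \sum_(e : edge n | (val e).1 == i) f e - \sum_(e : edge n | (val e).2 == i) f e
  = cut f i.+1 - cut f i.
Proof.
rewrite /cut [in LHS]big_mkcond [X in _ - X = _]big_mkcond [in RHS]big_mkcond.
rewrite [X in _ = _ - X]big_mkcond -!sumrB; apply: eq_bigr => e _.
rewrite -!(inj_eq val_inj) /= -/(src e) -/(dst e).
have := src_lt_dst e; move: (src e) (dst e) (nat_of_ord i) => a b c ab.
have [ac|ac] := eqVneq a c.
  have -> : (b == c) = false by lia.
  have -> : (a < c.+1 <= b)%N by lia.
  by have -> : (a < c <= b)%N = false by lia.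
have [bc|bc] := eqVneq b c.
  have -> : (a < c.+1 <= b)%N = false by lia.
  by have -> : (a < c <= b)%N by lia.
have -> : (a < c.+1 <= b)%N = (a < c <= b)%N by lia.
by rewrite !subrr.
Qed.

(** The conservation laws telescope by [cut_diff]; the one at the sink matches [cut f n.+1 = 0]. *)
Lemma net_flowP n (V : pzRingType) (N : nat -> nat) (f : edge n -> V) :
  (forall i : 'I_n.+1,
     \sum_(e : edge n | (val e).1 == i) f e
     - \sum_(e : edge n | (val e).2 == i) f e = (Nvec N n i)%:~R)
  <-> (forall k, (k <= n)%N -> cut f k = (psum N k)%:R).
Proof.
split => [net k|cutE i].
  elim: k => [_|k IH kn]; first by rewrite cut0 /psum big_ord0.
  have := net (Ordinal (leqW kn : (k < n.+1)%N)).
  rewrite cut_diff /= /Nvec /= kn IH ?(ltnW kn) // => /eqP.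
  by rewrite subr_eq psumS natrD addrC => /eqP.
rewrite cut_diff /Nvec; case: ltnP => ni.
  by rewrite !cutE // 1?ltnW // psumS natrD addrAC subrr add0r.
have -> : nat_of_ord i = n by have := ltn_ord i; lia.
by rewrite cutS cutE // sub0r mulrNz.
Qed.

Lemma cut_natr n (V : pzSemiRingType) (g : edge n -> nat) (k : nat) :
  cut (fun e => (g e)%:R : V) k = (cut g k)%:R.
Proof. by rewrite /cut natr_sum. Qed.

Lemma int_flowsP n (N : nat -> nat) (g : {ffun edge n -> nat}) :
  int_flows (Nvec N n) g <-> (forall k, (k <= n)%N -> cut g k = psum N k).
Proof.
have Z (P : pred (edge n)) : (\sum_(e | P e) g e)%N%:Z = \sum_(e | P e) (g e)%:R.
  by rewrite -natz natr_sum.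
rewrite /int_flows /=; split => [net k kn|cutE i].
  apply/eqP; rewrite -(eqr_nat int) -cut_natr; apply/eqP; move: k kn.
  by apply/net_flowP => i; rewrite -!Z net intz.
rewrite !Z -[RHS]intz; move: i; apply/net_flowP => k kn.
by rewrite cut_natr cutE.
Qed.

(** Exactly one edge of length 1 covers [k], so the slack at each point can be filled
    independently. *)
Lemma cut_complete n (V : nmodType) (f : edge n -> V) (d : nat -> V) (k : nat) :
  (0 < k <= n)%N ->
  cut (fun e => f e + (if dst e == (src e).+1 then d (dst e) else 0)) k
  = cut f k + d k.
Proof.
move=> /andP[k0 kn]; rewrite /cut big_split /=; congr (_ + _).
have [e0 [e0s e0d]] : exists e : edge n, src e = k.-1 /\ dst e = k.
  by apply: edge_exists; lia.
rewrite -big_mkcondr (big_pred1 e0) ?e0d // => e.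
apply/idP/eqP => [H|->]; last by rewrite e0s e0d; lia.
by apply: edge_eq; lia.
Qed.

Lemma le_cut n (R : numDomainType) (f : edge n -> R) (e : edge n) :
  (forall e, 0 <= f e) -> f e <= cut f (dst e).
Proof.
move=> f0; rewrite /cut (bigD1 e) /= ?src_lt_dst ?leqnn //.
by rewrite lerDl sumr_ge0.
Qed.

Lemma flow_le_psum (R : realType) n (N : nat -> nat) (f : edge n -> R) e :
  is_flow (Nvec N n) f -> f e <= (psum N n)%:R.
Proof.
move=> [f0 /net_flowP cutE]; apply: le_trans (le_cut e f0) _.
by rewrite cutE ?dst_le // ler_nat psum_homo // dst_le.
Qed.

(** * Integer flows *)


(** Capping the values at [psum N n] makes the ambient type finite and, by [int_flow_le], loses no
    integer flow. *)
Definition bounded_int_flows n (N : nat -> nat) :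
    {set {ffun edge n -> 'I_(psum N n).+1}} :=
  [set x : {ffun edge n -> 'I_(psum N n).+1} |
    [forall k : 'I_n.+1, cut (fun e => x e : nat) k == psum N k]]%SET.

Lemma bounded_int_flowsP n (N : nat -> nat) (x : {ffun edge n -> 'I_(psum N n).+1}) :
  x \in bounded_int_flows n N <->
  int_flows (Nvec N n) [ffun e => x e : nat].
Proof.
have E k : cut [ffun e => x e : nat] k = cut (fun e => x e : nat) k.
  by apply: eq_bigr => e _; rewrite ffunE.
rewrite inE; split => [/forallP cutE|/int_flowsP cutE].
  by apply/int_flowsP => k kn; rewrite E; apply/eqP/(cutE (Ordinal (kn : (k < n.+1)%N))).
by apply/forallP => k; rewrite -E cutE // -ltnS.
Qed.

Lemma int_flow_le n (N : nat -> nat) (g : {ffun edge n -> nat}) e :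
  int_flows (Nvec N n) g -> (g e <= psum N n)%N.
Proof.
move=> /int_flowsP cutE; apply: (@leq_trans (cut g (dst e))).
  by rewrite /cut (bigD1 e) /= ?src_lt_dst ?leqnn ?leq_addr.
by rewrite cutE ?dst_le // psum_homo // dst_le.
Qed.

Lemma int_flows_image n (N : nat -> nat) :
  int_flows (Nvec N n) =
  (fun x : {ffun edge n -> 'I_(psum N n).+1} => [ffun e => x e : nat])
    @` [set x | x \in bounded_int_flows n N].
Proof.
apply/seteqP; split => [g gN|_ [x /= /bounded_int_flowsP xA <-] //].
have gE : [ffun e => ([ffun e => inord (g e)] :
    {ffun edge n -> 'I_(psum N n).+1}) e : nat] = g.
  by apply/ffunP => e; rewrite !ffunE inordK // ltnS int_flow_le.
exists [ffun e => inord (g e)] => //=.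
by apply/bounded_int_flowsP; rewrite gE.
Qed.

Lemma finite_int_flows n (N : nat -> nat) : finite_set (int_flows (Nvec N n)).
Proof. by rewrite int_flows_image; apply: finite_image; apply: finite_finset. Qed.

Lemma KnE n (N : nat -> nat) : Kn (Nvec N n) = #|bounded_int_flows n N|.
Proof.
rewrite /Kn; set phi := fun x : {ffun edge n -> 'I_(psum N n).+1} =>
  [ffun e => x e : nat].
suff -> : fset_set (int_flows (Nvec N n)) =
    [fset phi x | x in bounded_int_flows n N]%fset.
  rewrite card_imfset /= -?cardE // => x y /ffunP xy.
  by apply/ffunP => e; apply: val_inj; have := xy e; rewrite !ffunE.
apply/fsetP => g; rewrite in_fset_set ?int_flows_image; last first.
  by rewrite -int_flows_image; exact: finite_int_flows.
apply/idP/imfsetP => [/set_mem[x xA <-]|[x xA ->]]; first by exists x.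
by apply/mem_set; exists x.
Qed.

Lemma leq_card_Kn n (N : nat -> nat) (T : finType)
    (F : T -> {ffun edge n -> nat}) (A : {set T}) :
  {in A &, injective F} -> (forall x, x \in A -> int_flows (Nvec N n) (F x)) ->
  (#|A| <= Kn (Nvec N n))%N.
Proof.
move=> Finj FA; rewrite -(card_in_imset (f := fun x =>
  [ffun e => inord (F x e)] : {ffun edge n -> 'I_(psum N n).+1})).
  rewrite KnE; apply: subset_leq_card; apply/fintype.subsetP => _ /imsetP[x xA ->].
  apply/bounded_int_flowsP.
  have -> : [ffun e => ([ffun e => inord (F x e)] :
      {ffun edge n -> 'I_(psum N n).+1}) e : nat] = F x; last exact: FA.
  by apply/ffunP => e; rewrite !ffunE inordK // ltnS int_flow_le //; exact: FA.
move=> x y xA yA /ffunP xy; apply: Finj => //; apply/ffunP => e.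
have := congr1 val (xy e); rewrite !ffunE /= !inordK // ltnS int_flow_le //;
  exact: FA.
Qed.

(** * Upper bound for the number of integer flows *)


Lemma sum_edge_dst n (V : nmodType) (j : 'I_n.+1) (F : 'I_n.+1 -> V) :
  \sum_(e : edge n | (val e).2 == j) F (val e).1 = \sum_(i : 'I_n.+1 | (i < j)%N) F i.
Proof.
rewrite [RHS](reindex_omap (fun e : edge n => (val e).1)
  (fun i => insub (i, j) : option (edge n))); last first.
  by move=> i ij /=; rewrite insubT.
apply: eq_bigl => e; apply/eqP/andP => [<-|[ej /eqP H]].
  by split; [exact: (valP e)|rewrite -surjective_pairing valK].
move: H; case: insubP => //= u _ uE [<-]; by rewrite uE.
Qed.

(** The sum is [psum N j] minus the inflow at [j], and every edge into [j] covers [j], so the inflow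
    is at most [cut f j = psum N j]. *)
Lemma slack_bounds (R : realType) n (N : nat -> nat) (f : edge n -> R) (j : 'I_n.+1) :
  is_flow (Nvec N n) f ->
  0 <= \sum_(e : edge n | (val e).2 == j) ((Nvec N n (val e).1)%:~R - f e)
    <= (psum N n)%:R.
Proof.
move=> [f0 /net_flowP cutE].
have jn : (j <= n)%N by rewrite -ltnS.
have inj : 0 <= \sum_(e : edge n | (val e).2 == j) f e <= (psum N j)%:R.
  rewrite sumr_ge0 //= -(cutE j jn) /cut.
  rewrite [leLHS]big_mkcond [leRHS]big_mkcond; apply: ler_sum => e _.
  case: eqP => [ej|_]; last by case: ifP.
  by rewrite /src /dst ej leqnn andbT -[in (_ < _)%N]ej (src_lt_dst e).
rewrite sumrB (sum_edge_dst j (fun i => (Nvec N n i)%:~R)).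
have -> : \sum_(i : 'I_n.+1 | (i < j)%N) (Nvec N n i)%:~R = (psum N j)%:R :> R.
  rewrite /psum natr_sum (big_ord_widen n.+1 (fun i => (N i)%:R)) ?(leqW jn) //.
  by apply: eq_bigr => i ij; rewrite /Nvec (leq_trans ij jn).
have : (psum N j)%:R <= (psum N n)%:R :> R by rewrite ler_nat psum_homo.
lra.
Qed.

Lemma sum_h_le_entropy (R : realType) n (N : nat -> nat) (f : edge n -> R) :
  is_flow (Nvec N n) f -> \sum_e h (f e) <= flow_entropy (Nvec N n) f.
Proof.
move=> ff; rewrite /flow_entropy lerDl sumr_ge0 // => j _.
by rewrite h_ge0 //; have /andP[] := slack_bounds j ff.
Qed.

Lemma entropy_le (R : realType) n (N : nat -> nat) (f : edge n -> R) :
  is_flow (Nvec N n) f ->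
  flow_entropy (Nvec N n) f <= \sum_e h (f e) + n.+1%:R * h (psum N n)%:R.
Proof.
move=> ff; rewrite /flow_entropy lerD2l.
apply: (@le_trans _ _ (\sum_(j : 'I_n.+1) h (psum N n)%:R)); last first.
  by rewrite sumr_const card_ord mulr_natl.
rewrite [leLHS]big_mkcond; apply: ler_sum => j _.
have /andP[g0 g1] := slack_bounds j ff.
by case: ifP => _; [exact: h_homo|rewrite h_ge0].
Qed.

Lemma entropy_has_ubound (R : realType) n (N : nat -> nat) :
  has_ubound [set flow_entropy (Nvec N n) f | f in @flow_polytope R _ (Nvec N n)].
Proof.
exists (\sum_(e : edge n) h (psum N n)%:R + n.+1%:R * h (psum N n)%:R).
move=> _ [f ff <-]; apply: le_trans (entropy_le ff) _.
rewrite lerD2r; apply: ler_sum => e _; apply: h_homo; first by case: ff.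
exact: flow_le_psum.
Qed.

Lemma entropy_le_sup (R : realType) n (N : nat -> nat) (f : edge n -> R) :
  is_flow (Nvec N n) f -> flow_entropy (Nvec N n) f <=
  sup [set flow_entropy (Nvec N n) f | f in @flow_polytope R _ (Nvec N n)].
Proof.
by move=> ff; apply: ub_le_sup; [exact: entropy_has_ubound|exists f].
Qed.

Lemma ln_Kn_le_sup (R : realType) n (N : nat -> nat) :
  (0 < Kn (Nvec N n))%N ->
  ln ((Kn (Nvec N n))%:R : R) <=
  sup [set flow_entropy (Nvec N n) f | f in @flow_polytope R _ (Nvec N n)].
Proof.
rewrite KnE => K0; apply: le_trans (ln_card_le_sum_h R K0) _.
set A := bounded_int_flows n N in K0 *; set K : R := #|A|%:R.
have K0' : 0 < K by rewrite ltr0n.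
(* The mean of all integer flows is itself a flow, because the cut equations are linear. *)
pose m (e : edge n) : R := (\sum_(x in A) (x e)%:R) / K.
suff mf : is_flow (Nvec N n) m.
  by apply: le_trans (sum_h_le_entropy mf) (entropy_le_sup mf).
split=> [e|]; first by rewrite divr_ge0 ?sumr_ge0 // ltW.
apply/net_flowP => k kn; rewrite /cut -mulr_suml exchange_big /=.
rewrite (eq_bigr (fun=> (psum N k)%:R)) => [|x].
  by rewrite sumr_const -[_ *+ #|_|]mulr_natr mulfK // gt_eqF.
rewrite inE => /forallP/(_ (Ordinal (kn : (k < n.+1)%N)))/eqP /= <-.
by rewrite -cut_natr.
Qed.

Lemma cut_complete_eq n (V : nmodType) (f : edge n -> V) (d s : nat -> V) :
  s 0%N = 0 -> (forall k, (0 < k <= n)%N -> cut f k + d k = s k) ->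
  forall k, (k <= n)%N ->
  cut (fun e => f e + (if dst e == (src e).+1 then d (dst e) else 0)) k = s k.
Proof.
move=> s0 ds [|k] kn; first by rewrite cut0 s0.
by rewrite cut_complete ?kn // ds.
Qed.

(** Filling the slack with unit edges turns the packing into a flow and only increases weights,
    while [h] is monotone. *)
Lemma packing_entropy_le_sup (R : realType) n (N : nat -> nat) (f : edge n -> R) :
  (forall e, 0 <= f e) -> (forall k, (0 < k <= n)%N -> cut f k <= (psum N k)%:R) ->
  \sum_e h (f e) <=
  sup [set flow_entropy (Nvec N n) f | f in @flow_polytope R _ (Nvec N n)].
Proof.
move=> f0 fcut; pose d k := (psum N k)%:R - cut f k.
pose g (e : edge n) := f e + (if dst e == (src e).+1 then d (dst e) else 0).
have fg e : f e <= g e.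
  rewrite /g lerDl; case: ifP => // _; rewrite subr_ge0 fcut // dst_le andbT.
  exact: leq_ltn_trans (src_lt_dst e).
have gf : is_flow (Nvec N n) g.
  split=> [e|]; first exact: le_trans (fg e).
  apply/net_flowP => k kn.
  apply: (cut_complete_eq (s := fun k => (psum N k)%:R)) => //.
    by rewrite /psum big_ord0.
  by move=> l ln; rewrite /d; ring.
apply: le_trans (entropy_le_sup gf); apply: le_trans (sum_h_le_entropy gf).
by apply: ler_sum => e _; exact: h_homo.
Qed.

(** * Growth of the maximal entropy *)


Lemma ln_le_h_inv (R : realType) (d : nat) :
  ln d.+2%:R / d.+1%:R <= h (d.+1%:R^-1) :> R.
Proof.
set x : R := d.+1%:R; have x0 : 0 < x by rewrite ltr0n.
have xS : d.+2%:R = x + 1 :> R by rewrite natr1.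
have e1 : 1 + x^-1 = (x + 1) / x by field; rewrite gt_eqF.
rewrite xS h_at e1 lnV ?posrE // ln_div ?posrE // ?addr_gt0 //.
have : ln x <= ln (x + 1) by rewrite ler_ln ?posrE ?addr_gt0 // lerDl.
rewrite opprK subrK mulrC => H.
by rewrite lerDr subr_ge0.
Qed.

(** Discrete form of the integral of [ln x / x]: for consecutive logarithms [b <= a],
    [(a ^+ 2 - b ^+ 2) / 2 <= a * (a - b)], and [a - b] is at most [D.+1%:R^-1]. *)
Lemma sum_ln_div_ge (R : realType) (D : nat) :
  ln D.+1%:R ^+ 2 / 2 <= \sum_(d < D) ln d.+2%:R / d.+1%:R :> R.
Proof.
elim: D => [|D IH]; first by rewrite big_ord0 ln1 expr0n mul0r.
rewrite big_ord_recr /=; apply: le_trans (lerD IH (lexx _)).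
have D1 : 0 < D.+1%:R :> R by rewrite ltr0n.
have D2 : 0 < D.+2%:R :> R by rewrite ltr0n.
have b0 : 0 <= ln D.+1%:R :> R by rewrite ln_ge0 // ler1n.
have ba : ln D.+1%:R <= ln D.+2%:R :> R by rewrite ler_ln ?posrE // ler_nat.
have ab : ln D.+2%:R - ln D.+1%:R <= D.+1%:R^-1 :> R.
  rewrite -ln_div ?posrE //; apply: le_trans (ln_le_subr1 _) _.
    by rewrite divr_gt0.
  by rewrite -[D.+2]addn1 natrD mulrDl divff ?gt_eqF // mul1r addrAC subrr add0r.
move: ab b0 ba; set a := ln D.+2%:R; set b := ln D.+1%:R; set c := _^-1.
move=> ab b0 ba.
have : a * (a - b) <= a * c by apply: ler_wpM2l => //; lra.
nra.
Qed.

(** The condition says that the length is at most [src e + 1], hence at most any point covered by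
    [e]; this keeps the cut at [k] below [k <= psum N k]. *)
Definition harmonic_packing (R : realType) n (e : edge n) : R :=
  if (dst e <= (src e).*2.+1)%N then (dst e - src e)%:R^-1 else 0.

Lemma harmonic_packing_ge0 (R : realType) n (e : edge n) :
  0 <= harmonic_packing R e.
Proof. by rewrite /harmonic_packing; case: ifP => // _; rewrite invr_ge0. Qed.

(* A point is covered by at most [d] intervals of length [d], each of weight
   [d^-1], and only the lengths [d <= k] contribute at [k]. *)
Lemma cut_harmonic_packing (R : realType) n (k : nat) :
  cut (@harmonic_packing R n) k <= k%:R.
Proof.
have [nk|kn] := ltnP n k.
  by rewrite /cut big_pred0 // => e; have := dst_le e; lia.
pose len (e : edge n) : 'I_n.+1 := inord (dst e - src e).
have lenE e : len e = (dst e - src e)%N :> nat.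
  by rewrite inordK //; have := dst_le e; lia.
rewrite /cut (partition_big len predT) //=.
apply: (@le_trans _ _ (\sum_(d : 'I_n.+1 | (0 < d <= k)%N) 1)); last first.
  rewrite (_ : \sum_(d < n.+1 | (0 < d <= k)%N) 1 = \sum_(d < k) 1 :> R).
    by rewrite sumr_const card_ord.
  rewrite big_mkcond big_ord_recl /= add0r.
  rewrite (big_ord_widen n (fun=> 1) kn).
  by rewrite [RHS]big_mkcond; apply: eq_bigr => i _; rewrite /bump add1n /=.
rewrite [leRHS]big_mkcond; apply: ler_sum => d _.
have [/andP[d0 dk]|dk] := boolP (0 < d <= k)%N; last first.
  rewrite big1 // => e /andP[/andP[ek ke] /eqP ed]; rewrite /harmonic_packing.
  case: ifP => // H; have := lenE e; have := src_lt_dst e; rewrite ed; lia.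
apply: (@le_trans _ _ (\sum_(e : edge n | (src e < k <= dst e)%N && (len e == d)) d%:R^-1)).
  apply: ler_sum => e /andP[_ /eqP ed]; rewrite /harmonic_packing -lenE ed.
  by case: ifP => // _; rewrite invr_ge0.
rewrite sumr_const -[_ *+ #|_|]mulr_natl ler_pdivrMr ?ltr0n // mul1r ler_nat.
case: d d0 {dk} => [[//|d] dn] _ /=.
rewrite -[leqRHS]card_ord; apply: (@leq_card_in _ _
  (fun e : edge n => inord (k.-1 - src e) : 'I_d.+1)) => e e'.
move=> /andP[ek /eqP ed] /andP[ek' /eqP ed'] /(congr1 val) /=.
have := lenE e; have := lenE e'; rewrite ed ed' /= => l1 l2.
rewrite !inordK; try lia.
by move=> H; apply: edge_eq; lia.
Qed.

(** The edges into [j] with nonzero weight have the lengths [1] to [uphalf j], and length [d]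
    contributes at least [ln (d + 1) / d]. *)
Lemma sum_harmonic_packing_dst (R : realType) n (j : 'I_n.+1) :
  ln (uphalf j).+1%:R ^+ 2 / 2
    <= \sum_(e : edge n | (val e).2 == j) h (harmonic_packing R e).
Proof.
pose F (i : nat) : R := h (if (j <= i.*2.+1)%N then (j - i)%:R^-1 else 0).
rewrite (eq_bigr (fun e : edge n => F (val e).1)); last first.
  by move=> e /eqP ej; rewrite /harmonic_packing /F /dst ej.
rewrite (sum_edge_dst j (fun i : 'I_n.+1 => F i)).
have jn : (j <= n.+1)%N by rewrite ltnW.
rewrite -(big_ord_widen _ F jn).
rewrite (reindex_inj rev_ord_inj) /=; apply: le_trans (sum_ln_div_ge R _) _.
have Dj : (uphalf j <= j)%N by lia.
rewrite (big_ord_widen _ (fun d => ln d.+2%:R / d.+1%:R) Dj) big_mkcond.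
apply: ler_sum => d _; rewrite /F.
have dj := ltn_ord d; have -> : (j - (j - d.+1))%N = d.+1 by lia.
have -> : (j <= (j - d.+1).*2.+1)%N = (d < uphalf j)%N by lia.
by case: ifP => _; rewrite ?h0 // ln_le_h_inv.
Qed.

Lemma sup_entropy_ge (R : realType) n (N : nat -> nat) :
  (forall i, (0 < N i)%N) -> (4 <= n)%N ->
  n%:R / 4 * ln (n%:R / 4) ^+ 2 <=
  sup [set flow_entropy (Nvec N n) f | f in @flow_polytope R _ (Nvec N n)].
Proof.
move=> N0 n4.
apply: le_trans (@packing_entropy_le_sup R n N (@harmonic_packing R n) _ _); first last.
- move=> k _; apply: le_trans (cut_harmonic_packing _ _ _) _.
  by rewrite ler_nat psum_ge.
- exact: harmonic_packing_ge0.
pose a (j : 'I_n.+1) : R :=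
  \sum_(e : edge n | (val e).2 == j) h (harmonic_packing R e).
have -> : \sum_(e : edge n) h (harmonic_packing R e) = \sum_j a j.
  by rewrite (partition_big (fun e : edge n => (val e).2) predT).
set c : R := ln (n%:R / 4) ^+ 2 / 2.
have n40 : 1 <= n%:R / 4 :> R by rewrite ler_pdivlMr // mul1r ler_nat.
have a0 j : 0 <= a j.
  by rewrite sumr_ge0 // => e _; rewrite h_ge0 ?harmonic_packing_ge0.
have ac (j : 'I_n.+1) : (n <= j.*2)%N -> c <= a j.
  move=> nj; apply: le_trans (sum_harmonic_packing_dst R j).
  rewrite ler_pM2r // lerXn2r ?nnegrE ?ln_ge0 ?ler1n //.
  rewrite ler_ln ?posrE ?ltr0n //; last by lra.
  by rewrite ler_pdivrMr // -natrM ler_nat; lia.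
(* Pair [j] with [n - j]: one of the two is at least [n / 2], so [ac] applies to it. *)
have H : n.+1%:R * c <= \sum_j a j + \sum_j a j.
  rewrite [X in _ <= _ + X](reindex_inj rev_ord_inj) /= -big_split /=.
  apply: (@le_trans _ _ (\sum_(j : 'I_n.+1) c)).
    by rewrite sumr_const card_ord mulr_natl.
  apply: ler_sum => j _; have [nj|nj] := leqP n j.*2.
    by rewrite -[c]addr0 lerD // ac.
  rewrite -[c]add0r lerD // ac //=; have := ltn_ord j; lia.
have c0 : 0 <= c by rewrite /c divr_ge0 // exprn_ge0 // ln_ge0.
have : n%:R * c <= n.+1%:R * c by rewrite ler_wpM2r // ler_nat.
have -> : n%:R / 4 * ln (n%:R / 4) ^+ 2 = n%:R * c / 2 :> R by rewrite /c; field.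
lra.
Qed.

(** * Blocks of edges *)


(** The integer part of the cube root. *)
Definition croot (d : nat) : nat := (\max_(t < d.+1 | (t ^ 3 <= d)%N) t)%N.

Lemma crootP (d : nat) : (croot d ^ 3 <= d < (croot d).+1 ^ 3)%N.
Proof.
have P0 : (0 < #|[pred t : 'I_d.+1 | (t ^ 3 <= d)%N]|)%N.
  by apply/card_gt0P; exists ord0; rewrite inE exp0n.
have [t td E] := eq_bigmax_cond (fun t : 'I_d.+1 => nat_of_ord t) P0.
rewrite /croot E; apply/andP; split; first exact: td.
rewrite ltnNge; apply/negP => td1.
have t1 : (t.+1 < d.+1)%N.
  by rewrite ltnS (leq_trans _ td1) // -[X in (X <= _)%N]expn1 leq_pexp2l.
have := @leq_bigmax_cond _ (fun t : 'I_d.+1 => (t ^ 3 <= d)%N)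
  (fun t => nat_of_ord t) (Ordinal t1) td1.
by rewrite -[X in (_ <= X)%N](esym E) ltnn.
Qed.

Lemma croot_eq (d t : nat) : (t ^ 3 <= d < t.+1 ^ 3)%N -> croot d = t.
Proof.
move=> /andP[td dt]; have /andP[cd dc] := crootP d.
have := leq_ltn_trans cd dt; have := leq_ltn_trans td dc.
by rewrite !ltn_exp2r //; lia.
Qed.

Lemma sum_const_le1 (I : finType) (P : pred I) (x : nat) :
  (forall i j, P i -> P j -> i = j) -> (\sum_(i | P i) x <= x)%N.
Proof.
move=> P1; rewrite sum_nat_const -[leqRHS]mul1n leq_mul2r.
by apply/orP; right; apply/card_le1_eqP => i j Pi Pj; exact: (P1 _ _ Pj Pi).
Qed.

Lemma sumr_const_le1 (R : numDomainType) (I : finType) (P : pred I) (x : R) :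
  0 <= x -> (forall i j, P i -> P j -> i = j) -> \sum_(i | P i) x <= x.
Proof.
move=> x0 P1; rewrite sumr_const.
have : (#|P| <= 1)%N by apply/card_le1_eqP => i j Pi Pj; exact: (P1 _ _ Pj Pi).
by case: #|P| => [|[|]].
Qed.

(* A label [(t, a)] stands for the edges of length in [[(t + 2) ^ 3, (t + 3) ^ 3)]
   starting in the [a]-th window of width [(t + 1) ^ 2].  With cubes there are only
   [O(\sum_t n / t ^ 2) = O(n)] labels, while the ratio of consecutive differences
   of cubes still tends to 1. *)
Definition label (T n : nat) : finType :=
  {l : 'I_n.+1 * 'I_n.+1 |
    (T <= l.1)%N && (l.2 * l.1.+1 ^ 2 + l.1.+2 ^ 3 <= n)%N}.

Definition scale T n (l : label T n) : nat := (val l).1.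
Definition window T n (l : label T n) : nat := (val l).2.
Definition width T n (l : label T n) : nat := ((scale l).+1 ^ 2)%N.

Definition in_block T n (l : label T n) (e : edge n) : bool :=
  (croot (dst e - src e) == (scale l).+2) && (src e %/ width l == window l)%N.

(* The inner block of [l]: its intervals are contained in every interval of the
   block [l], and the inner blocks of distinct labels are disjoint because the
   integer cube root of their lengths is [scale l]. *)
Definition inner T n (l : label T n) : finType :=
  ('I_(width l) * 'I_((scale l).+1 ^ 3 - scale l ^ 3))%type.

Definition inner_src T n (p : {l : label T n & inner l}) : nat :=
  ((window (tag p)).+1 * width (tag p) + (tagged p).1)%N.

Definition inner_dst T n (p : {l : label T n & inner l}) : nat :=
  (inner_src p + scale (tag p) ^ 3 + (tagged p).2)%N.

(** Points beyond every source in the window and not beyond the least possible end of an edge of the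
    block: each edge of the block covers all of them. *)
Definition inner_core T n (l : label T n) (k : nat) : bool :=
  ((window l).+1 * width l < k <= window l * width l + (scale l).+2 ^ 3)%N.

(** The reason why block lengths start at [t.+2 ^ 3]: after one window of outer sources and one of
    inner sources, an inner length, below [t.+1 ^ 3], still fits. *)
Lemma inner_width_le (t : nat) : (2 * t.+1 ^ 2 + t.+1 ^ 3 <= t.+2 ^ 3)%N.
Proof. by rewrite !expnS expn0; nia. Qed.

Lemma inner_core_src_dst T n (p : {l : label T n & inner l}) k :
  (inner_src p < k <= inner_dst p)%N -> inner_core (tag p) k.
Proof.
case: p => l [u v]; rewrite /inner_src /inner_dst /inner_core /inner_src /=.
have := ltn_ord u; have := ltn_ord v; rewrite /width.
have := inner_width_le (scale l); move: (window l) (scale l) (nat_of_ord u) (nat_of_ord v).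
move=> a t i j; rewrite !mulSn.
by move: (t.+1 ^ 2)%N (t ^ 3)%N (t.+1 ^ 3)%N (t.+2 ^ 3)%N => w x y z; lia.
Qed.

Lemma inner_dst_le T n (p : {l : label T n & inner l}) : (inner_dst p <= n)%N.
Proof.
case: p => l [u v]; rewrite /inner_dst /inner_src /=.
have /andP[_] := valP l; rewrite -/(scale l) -/(window l).
have := ltn_ord u; have := ltn_ord v; rewrite /width.
have := inner_width_le (scale l); move: (window l) (scale l) (nat_of_ord u) (nat_of_ord v).
move=> a t i j; rewrite !mulSn.
by move: (t.+1 ^ 2)%N (t ^ 3)%N (t.+1 ^ 3)%N (t.+2 ^ 3)%N => w x y z; lia.
Qed.

Lemma croot_inner T n (p : {l : label T n & inner l}) :
  croot (inner_dst p - inner_src p) = scale (tag p).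
Proof.
apply: croot_eq; rewrite /inner_dst -addnA addKn leq_addr /=.
by rewrite -ltn_subRL ltn_ord.
Qed.

(** The length determines the scale by [croot_inner]; dividing the source by the width then yields
    the window and the offset. *)
Lemma inner_inj T n (p q : {l : label T n & inner l}) :
  inner_src p = inner_src q -> inner_dst p = inner_dst q -> p = q.
Proof.
move=> es ed; have := croot_inner p; rewrite ed es croot_inner.
case: p q es ed => l [u v] [l' [u' v']].
rewrite /inner_dst /inner_src /= => es ed st.
have w0 : (0 < width l)%N by rewrite expn_gt0.
have ww : width l' = width l by rewrite /width st.
have aE : window l = window l'.
  have := ltn_ord u'; have := ltn_ord u; move: es.
  move: (nat_of_ord u) (nat_of_ord u'); rewrite ww => x y es xw yw.
  have := congr1 (divn^~ (width l)) es.
  by rewrite !divnMDl // !divn_small // !addn0 => -[].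
have ll : l = l'.
  apply: val_inj; rewrite [val l]surjective_pairing [val l']surjective_pairing.
  by congr pair; apply: val_inj; first exact: esym.
move: ll u' v' es ed {st ww aE} => <- u' v' /addnI /val_inj <-.
by move=> /addnI /val_inj <-.
Qed.

Lemma block_cross T n (l : label T n) (e : edge n) (k : nat) :
  in_block l e -> inner_core l k -> (src e < k <= dst e)%N.
Proof.
move=> /andP[/eqP ct /eqP ew] /andP[k1 k2].
have /andP[] := crootP (dst e - src e); rewrite ct => dl _.
have w0 : (0 < width l)%N by rewrite expn_gt0.
have := ltn_ceil (src e) w0; have := leq_trunc_div (src e) (width l).
have := src_lt_dst e; rewrite ew; lia.
Qed.

(** * Packings built from the inner blocks *)


(** Carries multiplicities from the inner blocks to edges, with 0 elsewhere: by [inner_inj] the sum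
    has at most one term. *)
Definition spread T n (m : label T n -> nat)
    (y : {dffun forall l, {ffun inner l -> 'I_(m l).+1}}) (e : edge n) : nat :=
  (\sum_(p : {l : label T n & inner l} |
      (inner_src p == src e) && (inner_dst p == dst e)) y (tag p) (tagged p))%N.

Lemma spread_inner T n (m : label T n -> nat)
    (y : {dffun forall l, {ffun inner l -> 'I_(m l).+1}}) (p : {l : label T n & inner l}) e :
  src e = inner_src p -> dst e = inner_dst p -> spread y e = y (tag p) (tagged p).
Proof.
move=> es ed; rewrite /spread es ed (big_pred1 p) // => q.
apply/andP/eqP => [[/eqP s /eqP d]|-> //]; exact: inner_inj.
Qed.

Lemma cut_spread_le T n (m : label T n -> nat)
    (y : {dffun forall l, {ffun inner l -> 'I_(m l).+1}}) (k : nat) :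
  (forall l, \sum_q y l q <= m l)%N ->
  (cut (spread y) k <= \sum_(l | inner_core l k) m l)%N.
Proof.
move=> ym; rewrite /cut /spread (exchange_big_dep predT) //=.
apply: (@leq_trans (\sum_(l | inner_core l k) \sum_q y l q)%N); last first.
  exact: leq_sum.
rewrite (sig_big_dep (fun l => inner_core l k) (fun _ _ => true)
  (fun l q => nat_of_ord (y l q))).
rewrite [leqRHS]big_mkcond; apply: leq_sum => p _ /=; rewrite andbT.
have [e Pe|P0] := pickP (fun e : edge n => (src e < k <= dst e)%N
  && ((inner_src p == src e) && (inner_dst p == dst e))); last first.
  by rewrite big_pred0.
have /andP[ek /andP[/eqP es /eqP ed]] := Pe.
rewrite inner_core_src_dst ?es ?ed //; apply: sum_const_le1 => e1 e2.
move=> /andP[_ /andP[/eqP s1 /eqP d1]] /andP[_ /andP[/eqP s2 /eqP d2]].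
by apply: edge_eq; rewrite -?s1 -?s2 -?d1 -?d2.
Qed.

(** An edge lies in at most one block, and by [block_cross] it covers the whole core of that
    block. *)
Lemma sum_blocks_cross_le (R : numDomainType) T n (f : edge n -> R) (k : nat) :
  (forall e, 0 <= f e) ->
  \sum_(l : label T n | inner_core l k) \sum_(e | in_block l e) f e <= cut f k.
Proof.
move=> f0; rewrite /cut (exchange_big_dep (fun e => (src e < k <= dst e)%N)) /=.
  apply: ler_sum => e _; apply: sumr_const_le1 => // l l'.
  move=> /andP[_ /andP[/eqP c w]] /andP[_ /andP[/eqP c' w']].
  have ss : scale l = scale l' by move: c; rewrite c' => -[].
  apply: val_inj; rewrite [val l]surjective_pairing [val l']surjective_pairing.
  congr pair; apply: val_inj; first exact: ss.
  by move: w w'; rewrite /width ss => /eqP ww /eqP; rewrite ww.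
by move=> l e lk le; exact: block_cross le lk.
Qed.

(** Each factor counts multisets of at most [m l] inner intervals. At a point [k] only blocks with
    [k] in their core contribute, and there [f] already carries mass at least [m l] across [k];
    hence every choice is a packing, and unit edges complete it to a flow. *)
Lemma prod_bin_le_Kn (R : realType) T n (N : nat -> nat) (f : edge n -> R)
    (m : label T n -> nat) : (2 <= T)%N ->
  is_flow (Nvec N n) f ->
  (forall l, (m l)%:R <= \sum_(e | in_block l e) f e) ->
  (\prod_(l : label T n) 'C(#|inner l| + m l, m l) <= Kn (Nvec N n))%N.
Proof.
move=> T2 [f0 /net_flowP cutE] mf; rewrite -card_dffun_sum_le.
pose A := [set y : {dffun forall l, {ffun inner l -> 'I_(m l).+1}} |
  [forall l, (\sum_q y l q <= m l)%N]]%SET.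
rewrite -/A.
have cutA y k : y \in A -> (k <= n)%N -> (cut (spread y) k <= psum N k)%N.
  rewrite inE => /forallP ym kn; rewrite -(ler_nat R) -(cutE k kn).
  apply: le_trans (sum_blocks_cross_le T k f0).
  apply: (@le_trans _ _ (\sum_(l : label T n | inner_core l k) m l)%:R).
    by rewrite ler_nat; exact: cut_spread_le.
  by rewrite natr_sum; apply: ler_sum => l _; exact: mf.
pose d (y : {dffun forall l, {ffun inner l -> 'I_(m l).+1}}) k :=
  (psum N k - cut (spread y) k)%N.
pose g (y : {dffun forall l, {ffun inner l -> 'I_(m l).+1}}) : {ffun edge n -> nat} :=
  [ffun e => (spread y e + if dst e == (src e).+1 then d y (dst e) else 0)%N].
apply: (@leq_card_Kn _ _ _ g) => [y y' yA y'A /ffunP gE|y yA]; last first.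
  apply/int_flowsP => k kn.
  rewrite -(@cut_complete_eq n nat (spread y) (d y) (psum N)) //.
  - by apply: eq_bigr => e _; rewrite ffunE.
  - by rewrite /psum big_ord0.
  - by move=> j /andP[_ jn]; exact: subnKC (cutA _ _ yA jn).
apply/ffunP => l; apply/ffunP => q; apply: val_inj.
pose p : {l : label T n & inner l} := Tagged (@inner T n) q.
(* Inner intervals have length at least 8, so the completion by unit edges leaves them untouched and
   [g y] determines [y]. *)
have sp3 : (8 <= scale l ^ 3)%N.
  have /andP[Tl _] := valP l.
  by rewrite (@leq_exp2r 2 (scale l) 3) // (leq_trans T2).
have [e [es ed]] : exists e : edge n, src e = inner_src p /\ dst e = inner_dst p.
  by apply: edge_exists; rewrite ?inner_dst_le // /inner_dst /=; lia.
have := gE e; rewrite !ffunE.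
have -> : (dst e == (src e).+1) = false by rewrite es ed /inner_dst /=; lia.
by rewrite !addn0 !(spread_inner _ es ed).
Qed.

(** * Block sizes *)


Lemma sum_inv_square_le (R : realType) (k : nat) :
  \sum_(t < k.+1) (t.+1 ^ 2)%:R^-1 <= 2 - k.+1%:R^-1 :> R.
Proof.
elim: k => [|k IH]; first by rewrite big_ord1 exp1n invr1; lra.
rewrite big_ord_recr /=; apply: le_trans (lerD IH (lexx _)) _.
set x : R := k.+1%:R; have x0 : 0 < x by rewrite ltr0n.
rewrite natrX -[k.+2%:R]natr1 -/x.
suff : 0 <= x^-1 - (x + 1)^-1 - ((x + 1) ^+ 2)^-1.
  by move: x^-1 (x + 1)^-1 ((x + 1) ^- 2) => a b c; lra.
have x1 : 0 < x + 1 by lra.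
rewrite [leRHS](_ : _ = (x * (x + 1) ^+ 2)^-1).
  by rewrite invr_ge0 mulr_ge0 ?exprn_ge0 // ltW.
by field; rewrite !gt_eqF.
Qed.

(** Scale [t] has at most [n / (t + 1)^2 + 1] windows, which adds up to at most [2 n + n + 1]. *)
Lemma card_label_le (R : realType) (T n : nat) : (0 < n)%N ->
  #|label T n|%:R <= 4 * n%:R :> R.
Proof.
move=> n0; rewrite /label card_sig.
apply: (@le_trans _ _ (\sum_(t < n.+1) (n%:R * (t.+1 ^ 2)%:R^-1 + 1))).
  rewrite -sum1_card natr_sum.
  rewrite (eq_bigl (fun l : 'I_n.+1 * 'I_n.+1 => true &&
    ((T <= l.1)%N && (l.2 * l.1.+1 ^ 2 + l.1.+2 ^ 3 <= n)%N))) //.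
  rewrite -(pair_big_dep (fun=> true) (fun t a : 'I_n.+1 =>
    (T <= t)%N && (a * t.+1 ^ 2 + t.+2 ^ 3 <= n)%N) (fun _ _ => 1)) /=.
  apply: ler_sum => t _; rewrite sumr_const.
  have w0 : (0 < t.+1 ^ 2)%N by rewrite expn_gt0.
  apply: (@le_trans _ _ ((n %/ t.+1 ^ 2).+1)%:R).
    rewrite ler_nat -[leqRHS]card_ord.
    apply: (@leq_card_in _ _ (fun a : 'I_n.+1 => inord a : 'I_(n %/ t.+1 ^ 2).+1)).
    move=> a b /andP[_ aw] /andP[_ bw] /(congr1 val) /=.
    by rewrite !inordK ?ltnS ?leq_divRL //; [exact: val_inj|lia|lia].
  rewrite -natr1 lerD2r ler_pdivlMr ?ltr0n // -natrM ler_nat.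
  exact: leq_trunc_div.
rewrite big_split /= -mulr_sumr sumr_const card_ord.
have n1 : 1 <= n%:R :> R by rewrite ler1n.
have : n%:R * (\sum_(t < n.+1) (t.+1 ^ 2)%:R^-1) <= n%:R * 2 :> R.
  apply: ler_wpM2l => //; apply: le_trans (sum_inv_square_le R n) _.
  by rewrite lerBlDr lerDl invr_ge0.
rewrite -natr1; lra.
Qed.

Definition outer_card T n (l : label T n) : nat :=
  (width l * ((scale l).+3 ^ 3 - (scale l).+2 ^ 3))%N.

Lemma card_inner T n (l : label T n) :
  #|inner l| = (width l * ((scale l).+1 ^ 3 - scale l ^ 3))%N.
Proof. by rewrite /inner card_prod !card_ord. Qed.

Lemma card_inner_gt0 T n (l : label T n) : (0 < #|inner l|)%N.
Proof.
by rewrite card_inner /width muln_gt0 expn_gt0 /= subn_gt0 ltn_exp2r.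
Qed.

Lemma card_inner_le T n (l : label T n) : (#|inner l| <= n * n)%N.
Proof.
have /andP[_] := valP l; rewrite card_inner /width -/(scale l) -/(window l).
move=> H; have H3 : ((scale l).+2 ^ 3 <= n)%N by lia.
apply: leq_mul; apply: leq_trans H3.
  by rewrite (leq_trans (n := (scale l).+1 ^ 3)) ?leq_pexp2l // leq_exp2r.
by rewrite (leq_trans (leq_subr _ _)) // leq_exp2r.
Qed.

(** An edge of the block is determined by the offset of its source in the window and the excess of
    its length over [(scale l).+2 ^ 3]. *)
Lemma card_block_le T n (l : label T n) :
  (#|[pred e : edge n | in_block l e]| <= outer_card l)%N.
Proof.
have w0 : (0 < width l)%N by rewrite expn_gt0.
have L0 : (0 < (scale l).+3 ^ 3 - (scale l).+2 ^ 3)%N.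
  by rewrite subn_gt0 ltn_exp2r.
rewrite /outer_card -(prednK w0) -(prednK L0) -[X in (_ <= X * _)%N]card_ord.
rewrite -[X in (_ <= _ * X)%N]card_ord -card_prod.
apply: (@leq_card_in _ _ (fun e : edge n =>
  (inord (src e %% width l) : 'I_(width l).-1.+1,
   inord (dst e - src e - (scale l).+2 ^ 3)
     : 'I_((scale l).+3 ^ 3 - (scale l).+2 ^ 3).-1.+1))).
move=> e e'; rewrite !inE => /andP[/eqP c /eqP w] /andP[/eqP c' /eqP w'].
have /andP[] := crootP (dst e - src e); have /andP[] := crootP (dst e' - src e').
rewrite c c' => b1 b2 b3 b4 [] /(congr1 val) /= + /(congr1 val) /=.
rewrite !inordK ?prednK ?ltn_mod //; try by rewrite ltn_sub2r // ltn_exp2r.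
move=> m1 m2.
have se : src e = src e'.
  by rewrite (divn_eq (src e) (width l)) (divn_eq (src e') (width l)) w w' m1.
have := src_lt_dst e; have := src_lt_dst e'.
by move=> q q'; apply: edge_eq => //; lia.
Qed.

(** The factor [width l] cancels. What remains is [3 t^2 + 15 t + 19] over [3 t^2 + 3 t + 1], at
    most [1 + 6 / t], with [T <= t]. *)
Lemma outer_inner_ratio (R : realType) T n (l : label T n) : (0 < T)%N ->
  (#|inner l| <= outer_card l)%N /\
  (outer_card l)%:R / #|inner l|%:R <= 1 + 6 / T%:R :> R.
Proof.
move=> T0; have /andP[Tl _] := valP l; rewrite -/(scale l) in Tl.
have Ei : ((scale l).+1 ^ 3 - scale l ^ 3 = 3 * scale l ^ 2 + 3 * scale l + 1)%N.
  by rewrite !expnS expn0; nia.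
have Eo : ((scale l).+3 ^ 3 - (scale l).+2 ^ 3 = 3 * scale l ^ 2 + 15 * scale l + 19)%N.
  by rewrite !expnS expn0; nia.
rewrite card_inner /outer_card Ei Eo; split; first by rewrite leq_mul //; lia.
have w0 : (0 < width l)%N by rewrite expn_gt0.
rewrite !natrM -mulf_div divff ?mul1r ?pnatr_eq0 -?lt0n //.
move: (scale l) Tl => t Tt.
have t0 : 0 < t%:R :> R by rewrite ltr0n; lia.
apply: (@le_trans _ _ (1 + 6 / t%:R)); last first.
  rewrite lerD2l; apply: ler_wpM2l => //.
  by rewrite lef_pV2 ?posrE ?ltr0n ?ler_nat //; lia.
rewrite ler_pdivrMr ?ltr0n; last by rewrite addn1.
have E (a b c : nat) : (a * t ^ 2 + b * t + c)%:R
    = a%:R * t%:R ^+ 2 + b%:R * t%:R + c%:R :> R.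
  by rewrite natrD natrD (natrM _ a) (natrM _ b) natrX.
rewrite !E.
move: (t%:R : R) t0 => x x0; rewrite -subr_ge0.
rewrite [leRHS](_ : _ = 6 * x + 6 / x); first by rewrite addr_ge0 ?mulr_ge0 ?invr_ge0 ?ltW.
by field; rewrite gt_eqF.
Qed.

(** * Lower bound for the number of integer flows *)


(** The constraint in [label] holds because the window starts at or before [src e] and [t.+2 ^ 3] is
    at most the length of [e], so their sum is at most [dst e <= n]. *)
Lemma block_exists T n (e : edge n) : (T.+2 ^ 3 <= dst e - src e)%N ->
  exists l : label T n, in_block l e.
Proof.
move=> Te; set d := (dst e - src e)%N in Te *.
have /andP[c1 c2] := crootP d.
have c3 : (T.+2 <= croot d)%N by rewrite -ltnS -(@ltn_exp2r _ _ 3) // (leq_ltn_trans Te).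
pose t := (croot d).-2; have ct : croot d = t.+2 by rewrite /t; lia.
rewrite ct in c1 c2 c3.
pose a := (src e %/ t.+1 ^ 2)%N.
have aw : (a * t.+1 ^ 2 <= src e)%N by exact: leq_trunc_div.
have en := dst_le e; have se := src_lt_dst e.
have t2 : (t < t.+2 ^ 3)%N.
  by rewrite (leq_trans (n := t.+2)) // -[X in (X <= _)%N]expn1 leq_exp2l.
have tn : (t < n.+1)%N by rewrite ltnS; lia.
have an : (a < n.+1)%N by rewrite ltnS (leq_trans (leq_div _ _)) //; lia.
have lP : (T <= t)%N && (a * t.+1 ^ 2 + t.+2 ^ 3 <= n)%N by apply/andP; split; lia.
exists (exist _ (Ordinal tn, Ordinal an) lP).
by rewrite /in_block -/d ct eqxx /=.
Qed.

Lemma card_short_edges_le (n q : nat) :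
  (#|[pred e : edge n | (dst e - src e < q)%N]| <= n.+1 * q)%N.
Proof.
case: q => [|q]; first by rewrite (eq_card0 (A := [pred e : edge n | _])).
rewrite -[X in (_ <= X * _)%N]card_ord -[X in (_ <= _ * X)%N]card_ord -card_prod.
apply: (@leq_card_in _ _ (fun e : edge n =>
  ((val e).1, inord (dst e - src e) : 'I_q.+1))) => e e'.
rewrite !inE => eq eq' [/(congr1 val) es /(congr1 val) /=].
rewrite !inordK // => ed; have := src_lt_dst e; have := src_lt_dst e'.
have {}es : src e = src e' by exact: es.
by move=> H H'; apply: edge_eq => //; lia.
Qed.

(** Jensen's inequality over the block, then [scaled_h_le] to pass to the inner block, then
    [h_le_ln_bin]. *)
Lemma block_entropy_le (R : realType) T n (l : label T n) (f : edge n -> R) (m : nat) :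
  (0 < T)%N -> (forall e, 0 <= f e) ->
  \sum_(e | in_block l e) f e <= m.+1%:R ->
  \sum_(e | in_block l e) h (f e)
  <= (1 + 6 / T%:R) * (ln ('C(#|inner l| + m, m)%:R) + (ln (1 + (n * n)%:R) + 1)).
Proof.
move=> T0 f0 fm; have [io ratio] := outer_inner_ratio R l T0.
have i0 := card_inner_gt0 l.
set F := \sum_(e | in_block l e) f e in fm *.
have F0 : 0 <= F by exact: sumr_ge0.
have i0' : 0 < #|inner l|%:R :> R by rewrite ltr0n.
have o0' : 0 < (outer_card l)%:R :> R by rewrite ltr0n (leq_trans i0).
apply: le_trans (sum_h_le o0' (fun e _ => f0 e) _) _.
  by rewrite ler_nat; exact: card_block_le.
rewrite -/F; apply: le_trans (scaled_h_le i0' _ F0) _; first by rewrite ler_nat.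
have H : #|inner l|%:R * h (F / #|inner l|%:R) <=
    ln ('C(#|inner l| + m, m)%:R) + (ln (1 + (n * n)%:R) + 1) :> R.
  apply: (@le_trans _ _ (#|inner l|%:R * h (m.+1%:R / #|inner l|%:R))).
    rewrite ler_pM2l //; apply: h_homo; first by rewrite divr_ge0.
    by rewrite ler_pM2r // invr_gt0.
  apply: le_trans (h_le_ln_bin R m i0) _; rewrite lerD2l lerD2r.
  rewrite ler_ln ?posrE ?lerD2l ?ler_nat ?card_inner_le //; exact: ltr_pwDl.
apply: ler_pM => //.
by rewrite mulr_ge0 // h_ge0 // divr_ge0.
Qed.

Lemma entropy_le_ln_Kn (R : realType) (T n : nat) (N : nat -> nat) (f : edge n -> R) :
  (2 <= T)%N -> (0 < n)%N -> is_flow (Nvec N n) f ->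
  flow_entropy (Nvec N n) f <=
  (1 + 6 / T%:R) *
    (ln (Kn (Nvec N n))%:R + 4 * n%:R * (ln (1 + (n * n)%:R) + 1))
  + n.+1%:R * (T.+2 ^ 3).+1%:R * (ln (1 + (psum N n)%:R) + 1).
Proof.
move=> T2 n0 ff; have [f0 _] := ff.
apply: le_trans (entropy_le ff) _.
set c : R := ln (1 + (n * n)%:R) + 1.
have c0 : 0 <= c by rewrite addr_ge0 // ln_ge0 // lerDl.
set s : R := ln (1 + (psum N n)%:R) + 1.
have hs : h (psum N n)%:R <= s by exact: h_le_ln.
have hs0 : 0 <= h (psum N n)%:R :> R by exact: h_ge0.
(* Rounding down makes [m l] admissible in [prod_bin_le_Kn], while [(m l).+1] still bounds the mass
   for [block_entropy_le]. *)
pose m (l : label T n) := Num.truncn (\sum_(e | in_block l e) f e).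
have mP (l : label T n) :
    (m l)%:R <= \sum_(e | in_block l e) f e < (m l).+1%:R.
  by apply: truncn_itv; exact: sumr_ge0.
have short : \sum_(e : edge n | (dst e - src e < T.+2 ^ 3)%N) h (f e)
    <= n.+1%:R * (T.+2 ^ 3)%:R * h (psum N n)%:R.
  apply: (@le_trans _ _ (\sum_(e : edge n | (dst e - src e < T.+2 ^ 3)%N) h (psum N n)%:R)).
    by apply: ler_sum => e _; apply: h_homo => //; exact: flow_le_psum.
  rewrite sumr_const -[_ *+ #|_|]mulr_natl; apply: ler_wpM2r => //.
  by rewrite -natrM ler_nat; exact: card_short_edges_le.
have long : \sum_(e : edge n | ~~ (dst e - src e < T.+2 ^ 3)%N) h (f e)
    <= \sum_(l : label T n) \sum_(e | in_block l e) h (f e).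
  rewrite (exchange_big_dep predT) //= [leLHS]big_mkcond; apply: ler_sum => e _.
  case: ifP => [|_]; last by rewrite sumr_ge0 // => l _; exact: h_ge0.
  rewrite -leqNgt => /block_exists[l le].
  by rewrite (bigD1 l) //= lerDl sumr_ge0 // => i _; exact: h_ge0.
have blocks : \sum_(l : label T n) \sum_(e | in_block l e) h (f e)
    <= (1 + 6 / T%:R) * (ln (Kn (Nvec N n))%:R + 4 * n%:R * c).
  apply: (@le_trans _ _ (\sum_(l : label T n) (1 + 6 / T%:R) *
      (ln ('C(#|inner l| + m l, m l)%:R) + c))).
    apply: ler_sum => l _; apply: block_entropy_le => //; first by lia.
    by have /andP[_ /ltW] := mP l.
  rewrite -mulr_sumr; apply: ler_wpM2l; first by rewrite addr_ge0 // divr_ge0.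
  rewrite big_split /= sumr_const -[c *+ _]mulr_natl; apply: lerD.
    rewrite -ln_prod => [|l]; last by rewrite ltr0n bin_gt0 leq_addl.
    have P0 : (0 < \prod_(l : label T n) 'C(#|inner l| + m l, m l))%N.
      by rewrite prodn_gt0 // => l; rewrite bin_gt0 leq_addl.
    have PK := prod_bin_le_Kn T2 ff (fun l => proj1 (andP (mP l))).
    by rewrite -natr_prod ler_ln ?posrE ?ltr0n ?ler_nat // (leq_trans P0 PK).
  by apply: ler_wpM2r => //; exact: card_label_le.
rewrite (bigID (fun e : edge n => (dst e - src e < T.+2 ^ 3)%N)) /=.
have n1 : 0 <= n.+1%:R :> R by [].
(* The successor adds the vertex terms of [entropy_le] to the short edges. *)
have : n.+1%:R * (T.+2 ^ 3).+1%:R * h (psum N n)%:R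
    <= n.+1%:R * (T.+2 ^ 3).+1%:R * s :> R.
  by apply: ler_wpM2l => //; rewrite mulr_ge0.
rewrite -natr1.
move: short long blocks; move: (ln _) => K; lra.
Qed.

(** * The limit *)


(** All [n] summands are at most [a n^p], whence [1 + psum N n <= (1 + a) n^(1 + p)]. *)
Lemma ln_psum_le (R : realType) (N : nat -> nat) (a p : R) (n : nat) :
  0 <= a -> 0 <= p -> (forall i, (N i)%:R <= a * (i.+1%:R `^ p)) -> (0 < n)%N ->
  ln (1 + (psum N n)%:R) <= ln (1 + a) + (1 + p) * ln n%:R.
Proof.
move=> a0 p0 Na n0; have n0' : 0 < n%:R :> R by rewrite ltr0n.
have pow0 : 0 < n%:R `^ p by rewrite powR_gt0.
have pow1 : 1 <= n%:R `^ p.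
  rewrite -[leLHS](_ : 1 `^ p = 1); last by rewrite powR1.
  by rewrite ge0_ler_powR ?nnegrE // ler1n.
have S : (psum N n)%:R <= n%:R * (a * n%:R `^ p).
  rewrite /psum natr_sum; apply: (@le_trans _ _ (\sum_(i < n) a * n%:R `^ p)).
    apply: ler_sum => i _; apply: le_trans (Na i) _; apply: ler_wpM2l => //.
    by rewrite ge0_ler_powR ?nnegrE // ler_nat.
  by rewrite sumr_const card_ord mulr_natl.
have -> : ln (1 + a) + (1 + p) * ln n%:R = ln ((1 + a) * (n%:R * n%:R `^ p)).
  rewrite lnM ?posrE ?mulr_gt0 //; last exact: ltr_pwDl.
  by rewrite lnM ?posrE // ln_powR; ring.
rewrite ler_ln ?posrE ?mulr_gt0 //; try exact: ltr_pwDl.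
have : 1 <= n%:R * n%:R `^ p by rewrite mulr_ege1 // ler1n.
lra.
Qed.

Lemma ln_1Dsquare_le (R : realType) (n : nat) : (2 <= n)%N ->
  ln (1 + (n * n)%:R) <= 3 * ln n%:R :> R.
Proof.
move=> n2; have n0 : 0 < n%:R :> R by rewrite ltr0n; lia.
rewrite mulr_natl -lnXn // ler_ln ?posrE ?exprn_gt0 ?ltr_pwDl //.
by rewrite -natrX nat1r ler_nat !expnS expn0; nia.
Qed.

(** In [28 * 4], 7 bounds [1 + 6 / T], one 4 counts labels per vertex, and the other comes from
    [ln (1 + n^2) + 1 <= 4 (ln n + 1)]. The factor 2 is [n + 1 <= 2 n]. *)
Lemma sup_entropy_le (R : realType) (T n : nat) (N : nat -> nat) (a p : R) :
  (forall i, (0 < N i)%N) ->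
  0 <= a -> 0 <= p -> (forall i, (N i)%:R <= a * (i.+1%:R `^ p)) ->
  (2 <= T)%N -> (4 < n)%N ->
  sup [set flow_entropy (Nvec N n) f | f in @flow_polytope R _ (Nvec N n)] <=
  (1 + 6 / T%:R) * ln (Kn (Nvec N n))%:R
  + (28 * 4 + 2 * (T.+2 ^ 3).+1%:R * (ln (1 + a) + 2 + p)) * (n%:R * (ln n%:R + 1)).
Proof.
move=> Npos a0 p0 Na T2 n4.
set c1 : R := 1 + 6 / T%:R; set q : R := (T.+2 ^ 3).+1%:R; set L : R := ln n%:R.
have n1 : 1 <= n%:R :> R by rewrite ler1n; lia.
have L0 : 0 <= L by rewrite ln_ge0.
have c0 : 0 <= c1 by rewrite addr_ge0 // divr_ge0.
have c4 : c1 <= 7.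
  rewrite /c1; have : 6 / T%:R <= 6 :> R.
    by rewrite ler_pdivrMr ?ltr0n ?ler_peMr ?ler1n //; lia.
  lra.
have la0 : 0 <= ln (1 + a) by rewrite ln_ge0 // lerDl.
apply: ge_sup => [|_ [f ff <-]].
  (* The empty set has [sup] 0, against the lower bound of [sup_entropy_ge], which is positive for
     [4 < n]. *)
  apply/set0P/negP => /eqP E; have := sup_entropy_ge R Npos (ltnW n4).
  rewrite E sup0; apply/negP; rewrite -ltNge mulr_gt0 //.
    by rewrite divr_gt0 // ltr0n; lia.
  by rewrite exprn_gt0 // ln_gt0 // ltr_pdivlMr // mul1r ltr_nat.
apply: le_trans (entropy_le_ln_Kn T2 _ ff) _; first by lia.
rewrite -/c1 -/q mulrDr -addrA lerD2l (mulrDl (28 * 4)); apply: lerD.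
  apply: (@le_trans _ _ (7 * (4 * n%:R * (ln (1 + (n * n)%:R) + 1)))).
    by apply: ler_wpM2r => //; rewrite mulr_ge0 // addr_ge0 // ln_ge0 // lerDl.
  rewrite (_ : 28 * 4 * _ = 7 * (4 * n%:R * (4 * (L + 1)))); last by ring.
  apply: ler_wpM2l => //; apply: ler_wpM2l => //.
  have : ln (1 + (n * n)%:R) <= 3 * L by apply: ln_1Dsquare_le; lia.
  lra.
have q0 : 0 <= q by [].
apply: (@le_trans _ _ (2 * n%:R * q * ((ln (1 + a) + 2 + p) * (L + 1)))); last first.
  by rewrite le_eqVlt; apply/orP; left; apply/eqP; ring.
apply: ler_pM.
- by rewrite mulr_ge0.
- by rewrite addr_ge0 // ln_ge0 // lerDl.
- by apply: ler_wpM2r => //; rewrite -natr1; lra.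
have := ln_psum_le a0 p0 Na (ltn_trans (isT : 0 < 4)%N n4); rewrite -/L => H.
apply: (@le_trans _ _ (ln (1 + a) + (1 + p) * L + 1)); first by lra.
have : 0 <= ln (1 + a) * L by rewrite mulr_ge0.
have : 0 <= p * L by rewrite mulr_ge0.
nra.
Qed.

(** With [m = 0] on every block, the product of binomials is 1. *)
Lemma Kn_gt0 (R : realType) n (N : nat -> nat) (f : edge n -> R) :
  is_flow (Nvec N n) f -> (0 < Kn (Nvec N n))%N.
Proof.
move=> ff; have [f0 _] := ff.
have := @prod_bin_le_Kn R 2 n N f (fun=> 0%N) isT ff (fun l => sumr_ge0 _ (fun e _ => f0 e)).
by rewrite big1 // => l _; rewrite bin0.
Qed.

Theorem theorem1p6 (R : realType) (N : nat -> nat)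
  (Npos : forall i, (0 < N i)%N)
  (Npoly : exists a p : R, 0 <= a /\ 0 <= p /\
      forall i : nat, (N i)%:R <= a * ((i.+1)%:R `^ p)) :
  (fun n : nat =>
     ln ((Kn (Nvec N n))%:R : R)
     / sup [set flow_entropy (Nvec N n) f | f in @flow_polytope R _ (Nvec N n)])
  @ \oo --> (1 : R).
Proof.
have [a [p [a0 [p0 Na]]]] := Npoly.
apply/cvgrPdist_le => e e0.
(* The final estimate loses [2 * d], since [(1 - 2 d) (1 + d) <= 1 - d]; hence [d <= e / 2]. *)
pose d := Num.min (e / 2) (1 / 2).
have d0 : 0 < d by rewrite lt_min !divr_gt0.
have de : d <= e / 2 by rewrite ge_min lexx.
have d1 : d <= 1 / 2 by rewrite ge_min lexx orbT.
pose T := (Num.truncn (6 / d)).+2.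
have T2 : (2 <= T)%N by [].
have Td : 6 / T%:R <= d.
  have /andP[_ H] := @truncn_itv R (6 / d) (divr_ge0 (ler0n _ 6) (ltW d0)).
  have T0 : 0 < T%:R :> R by rewrite ltr0n.
  rewrite ler_pdivrMr // mulrC -ler_pdivrMr //; apply: le_trans (ltW H) _.
  by rewrite ler_nat.
pose A : R := 28 * 4 + 2 * (T.+2 ^ 3).+1%:R * (ln (1 + a) + 2 + p).
have A0 : 0 <= A.
  have : 0 <= ln (1 + a) by rewrite ln_ge0 // lerDl.
  move=> la; rewrite /A addr_ge0 //; apply: mulr_ge0 => //; lra.
(* For [L >= X]: [L >= 1], [L - ln 4 >= L / 2], and [32 A <= d L]. The last gives
   [A n (L + 1) <= 2 A n L <= d n L^2 / 16], so the error is at most [d * H]. *)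
pose X : R := 1 + 2 * ln 4 + 32 * A / d.
near=> n.
have n4 : (4 < n)%N by near: n; exact: nbhs_infty_gt.
have nX : expR X <= n%:R by near: n; exact: nbhs_infty_ger.
set H := sup _; set K : R := ln _; set L : R := ln n%:R.
have n0 : 0 < n%:R :> R by rewrite ltr0n; lia.
have LX : X <= L by rewrite -(expRK X) ler_ln ?posrE ?expR_gt0.
have l4 : 0 <= ln 4 :> R by rewrite ln_ge0 // ler1n.
have Ad : 0 <= 32 * A / d by rewrite divr_ge0 ?mulr_ge0 // ltW.
have HL : n%:R / 4 * (L - ln 4) ^+ 2 <= H.
  by have := sup_entropy_ge R Npos (ltnW n4); rewrite ln_div ?posrE.
have HA : n%:R * (L * L) / 16 <= H.
  apply: le_trans HL; rewrite (_ : _ / 16 = n%:R / 4 * (L / 2) ^+ 2); last by field.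
  apply: ler_wpM2l; first by rewrite divr_ge0 // ltW.
  rewrite lerXn2r ?nnegrE //; move: LX; rewrite /X; lra.
have L1 : 1 <= L by move: LX; rewrite /X; lra.
have H0 : 0 < H.
  by apply: lt_le_trans HA; rewrite divr_gt0 // mulr_gt0 // mulr_gt0; lra.
have err : A * (n%:R * (L + 1)) <= d * H.
  apply: (@le_trans _ _ (d * (n%:R * (L * L) / 16))); last by rewrite ler_pM2l.
  apply: (@le_trans _ _ (A * (n%:R * (2 * L)))).
    by apply: ler_wpM2l => //; rewrite ler_pM2l //; lra.
  have AL : 32 * A <= d * L.
    have : 32 * A / d <= L by move: LX; rewrite /X; lra.
    by rewrite ler_pdivrMr // (mulrC L).
  rewrite (_ : A * _ = n%:R * L / 16 * (32 * A)); last by field.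
  rewrite (_ : d * _ = n%:R * L / 16 * (d * L)); last by field.
  by apply: ler_wpM2l => //; rewrite divr_ge0 // mulr_ge0 //; lra.
have HK : H <= (1 + 6 / T%:R) * K + A * (n%:R * (L + 1)).
  exact: sup_entropy_le.
(* Since [H > 0], the set under [sup] is not empty, and any real flow yields an integer one. *)
have K0 : (0 < Kn (Nvec N n))%N.
  have [E|/set0P[_ [f ff _]]] := eqVneq
    [set flow_entropy (Nvec N n) f | f in @flow_polytope R _ (Nvec N n)] set0.
    by move: H0; rewrite /H E sup0 ltxx.
  exact: Kn_gt0 ff.
have KH : K <= H by exact: ln_Kn_le_sup.
have Kge : 0 <= K by rewrite ln_ge0 // ler1n.
have lo : (1 - d) * H <= (1 + d) * K.
  have : (1 + 6 / T%:R) * K <= (1 + d) * K by apply: ler_wpM2r => //; lra.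
  lra.
rewrite ger0_norm; last by rewrite subr_ge0 ler_pdivrMr // mul1r.
rewrite lerBlDr -lerBlDl ler_pdivlMr //.
apply: (@le_trans _ _ ((1 - 2 * d) * H)); first by rewrite ler_pM2r //; lra.
nra.
Unshelve. all: by end_near. Qed.
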